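(* Let $n>m\ge 1$ and let $f(X)=\sum_{i=0}^{n}a_{i}X^{i}$, $g(X)=\sum_{i=0}^{m}b_{i}X^{i}\in\mathbb{Z}[X]$ with $a_{0}a_{n}b_{0}b_{m}\neq 0$. Suppose that $|Res(f,g)|=pq$ with $p$ a prime number and $q$ a positive integer. Suppose also that for two positive real numbers $A,B$ with $B\geq A+q^{1/m}$ we have $|a_{n}|>\sum_{i=0}^{n-1}|a_{i}|A^{i-n}$ and $|b_{0}|>\sum_{i=1}^{m}|b_{i}|B^{i}$. Let $M$ and $N$ be integers with $Ma_0+Nb_0\neq 0$, satisfying one of the following two pairs of inequalities: $$|M|\leq\frac{B-A}{q^{1/m}}\quad\text{and}\quad |N|\leq|M|\cdot\frac{|a_{n}|-\sum_{i=0}^{n-1}|a_{i}|(B-q^{1/m}|M|)^{i-n}}{\sum_{i=0}^{m}|b_{i}|(B-q^{1/m}|M|)^{i-n}},$$ or $$|N|^{\frac{n}{m}}\leq\frac{B-A}{q^{1/m}|a_n|^{\frac{n-m}{m}}}\quad\text{and}\quad |M|\leq|N|\cdot\frac{|b_{0}|-\sum_{i=1}^{m}|b_{i}|\left(A+q^{1/m}|a_n|^{\frac{n-m}{m}}|N|^{\frac{n}{m}}\right)^{i}}{\sum_{i=0}^{n}|a_{i}|\left(A+q^{1/m}|a_n|^{\frac{n-m}{m}}|N|^{\frac{n}{m}}\right)^{i}}.$$ Then the polynomial $Mf(X)+Ng(X)$ is irreducible over $\mathbb{Q}$.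
   Context: $Res(f,g)$ is the resultant of $f$ and $g$. *)

(* Defs.v *)
From mathcomp Require Export all_boot all_order all_algebra.
From mathcomp Require Export all_reals exp.
Set Implicit Arguments.
Unset Strict Implicit.
Unset Printing Implicit Defensive.

(* Main.v *)
From HB Require Import structures.
From mathcomp Require Import zify ring lra.
From mathcomp Require Import complex algC.
Require Import Defs.
Import Order.TTheory GRing.Theory Num.Theory.
Local Open Scope ring_scope.
Set Implicit Arguments.
Unset Strict Implicit.
Unset Printing Implicit Defensive.

(** The proof separates roots and compares resultants.  Put [h = M f + N g].
    Cauchy-type estimates confine the complex roots of [h] (by either pair of
    inequalities) and those of a second polynomial [G] (by the assumption on
    it), namely [G = g] for the first pair and [G = f] for the second, to
    opposite sides of an annulus centred at the origin.  Its width is a number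
    [s] such that [s ^ deg G >= K], where [|Res (h, G)| = p K].

    The latter identity holds because [Res (_, G)] only depends on the class of
    its first argument modulo [G], up to powers of [lc G]
    ([int_resultant_modl]): modulo [g], [h] is [M f], and modulo [f], it is
    [N g].  In the first case [K = q |M|^m] and [s = q^(1/m) |M|]; in the second
    one [K = q |a_n|^(deg h - m) |N|^n], while
    [s^m = q |a_n|^(n - m) |N|^n >= 1], so that [s^n >= s^m >= K].

    Suppose now [h = U V] with [U], [V] nonconstant integer polynomials, which
    by Gauss' lemma covers every factorization over the rationals.  The
    resultant is multiplicative, so [Res (U, G) Res (V, G)] is [p K] up to sign,
    and since [p] is prime it divides one of the factors; the other one is then
    at most [K] in absolute value.  But the expression of the resultant as a
    product of differences of roots shows that each factor exceeds
    [s ^ deg G >= K] ([norm_resultant_gt]), a contradiction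
    ([irreducible_of_resultant]).

    The properties of the resultant all come from one factorization of the
    Sylvester matrix ([resultant_mulmod]): up to a power of [lc Q], the
    resultant of [P] and [Q] is the determinant of multiplication by [P] on
    [F[X] / (Q)]. *)

(** * Resultants as determinants of multiplication maps *)

Section MulMod.
Variables (F : fieldType) (Q : {poly F}).
Implicit Types (P : {poly F}) (d : nat).

Definition mulmod d P (u : 'rV[F]_d) : 'rV[F]_d :=
  poly_rV ((rVpoly u * P) %% Q).

Fact mulmod_linear d P : linear (@mulmod d P).
Proof.
by move=> a u v; rewrite /mulmod !linearP /= mulrDl -scalerAl modpD modpZl linearP.
Qed.
HB.instance Definition _ d P := GRing.isLinear.Build F 'rV[F]_d 'rV[F]_d _
  (@mulmod d P) (@mulmod_linear d P).

(** The matrix of multiplication by [P] on [F[X] / (Q)] in the monomial basis,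
    acting on row vectors, when [d] is the degree of [Q].  Keeping [d] apart
    from [Q] lets [Q] be rescaled without a change of type. *)
Definition mulmod_mx d P : 'M[F]_d := lin1_mx (@mulmod d P).

Lemma mul_mulmod_mx d P (u : 'rV_d) :
  u *m mulmod_mx d P = poly_rV ((rVpoly u * P) %% Q).
Proof. by rewrite mul_rV_lin1. Qed.

Lemma mulmod_mxC d c : size Q = d.+1 -> mulmod_mx d c%:P = c%:M.
Proof.
move=> sQ; apply/row_matrixP=> i; rewrite rowE mul_mulmod_mx.
rewrite mulrC mul_polyC modp_small; last first.
  by rewrite sQ ltnS (leq_trans (size_scale_leq _ _)) // size_poly.
by rewrite linearZ /= rVpolyK rowE mul_mx_scalar.
Qed.

Lemma mulmod_mxM d P1 P2 : size Q = d.+1 ->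
  mulmod_mx d (P1 * P2) = mulmod_mx d P1 *m mulmod_mx d P2.
Proof.
move=> sQ; apply/row_matrixP=> i; rewrite !rowE mulmxA !mul_mulmod_mx.
rewrite poly_rV_K; last by rewrite -ltnS -sQ ltn_modp -size_poly_gt0 sQ.
by rewrite [X in _ = poly_rV (X %% Q)]mulrC modp_mul mulrA mulrC.
Qed.

Lemma mulmod_mx_addl d P P1 : mulmod_mx d (P1 * Q + P) = mulmod_mx d P.
Proof.
apply/row_matrixP=> i; rewrite !rowE !mul_mulmod_mx.
by rewrite mulrDr modpD mulrA modp_mull add0r.
Qed.

End MulMod.

Lemma mulmod_mxZr (F : fieldType) (Q P : {poly F}) d c : c != 0 ->
  mulmod_mx (c *: Q) d P = mulmod_mx Q d P.
Proof.
move=> c0; apply/row_matrixP=> i; rewrite !rowE !mul_mulmod_mx.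
by rewrite modpZr.
Qed.

(** Euclidean division of the rows [X^i P] of the Sylvester matrix by [Q] writes
    it as a product of two block triangular matrices: the first one carries the
    remainders, i.e. the multiplication matrix, and the quotients; the second
    one has the coefficients of the [X^i Q] in its lower rows, hence a
    triangular block with diagonal [lc Q]. *)
Lemma resultant_mulmod (F : fieldType) (P Q : {poly F}) : Q != 0 ->
  resultant P Q =
    lead_coef Q ^+ (size P).-1 * \det (mulmod_mx Q (size Q).-1 P).
Proof.
move=> Q0; rewrite /resultant; set n := (size P).-1; set m := (size Q).-1.
have sQ : size Q = m.+1 by rewrite /m prednK // size_poly_gt0.
pose band r d : 'M[F]_(d, m + n) := lin1_mx (poly_rV \o r \o* rVpoly).
have bandE r d (u : 'rV_d) : u *m band r d = poly_rV (rVpoly u * r).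
  by rewrite /band mul_rV_lin1.
pose quo : 'M[F]_(m, n) := \matrix_(i, j) (('X^i * P) %/ Q)`_j.
have szq (i : 'I_m) : leq (size (('X^i * P) %/ Q)) n.
  rewrite size_divp // -/m.
  have [->|P0] := eqVneq P 0; first by rewrite mulr0 size_poly0.
  have : size ('X^i * P) = (i + size P)%N.
    by rewrite size_monicM ?monicXn // size_polyXn addSn.
  by move=> ->; have := ltn_ord i; move: P0; rewrite -size_poly_gt0 /n; lia.
have -> : Sylvester_mx P Q =
    block_mx (mulmod_mx Q m P) quo 0 1%:M *m
    col_mx (row_mx 1%:M 0) (band Q n).
  rewrite mul_block_col mul0mx mul1mx add0r.
  congr col_mx; apply/row_matrixP=> i; rewrite rowE [in RHS]rowE bandE.
  rewrite mulmxDr !mulmxA mul_mulmod_mx bandE rVpoly_delta -rowE.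
  have -> : row i quo = poly_rV (('X^i * P) %/ Q).
    by apply/rowP=> j; rewrite !mxE.
  rewrite poly_rV_K // mul_mx_row mulmx1 mulmx0.
  set r := _ %% _; have -> : row_mx (poly_rV r : 'rV_m) 0 = poly_rV r :> 'rV_(m + n).
    apply/rowP=> j; rewrite !mxE; case: splitP => k ->; rewrite !mxE //.
    by rewrite nth_default // (@leq_trans m) ?leq_addr // -ltnS -sQ ltn_modp.
  by rewrite -linearD /= [X in poly_rV X](divp_eq _ Q) addrC.
rewrite det_mulmx det_ublock det1 mulr1 mulrC; congr (_ * _).
rewrite -[band Q n]hsubmxK -/(block_mx _ _ _ _) det_lblock det1 mul1r.
rewrite det_trig; last first.
  apply/is_trig_mxP=> i j ij; rewrite !mxE /= rVpoly_delta coefXnM ltnNge.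
  by rewrite nth_default ?if_same // sQ /=; lia.
under eq_bigr => i _ do
  rewrite !mxE /= rVpoly_delta coefXnM ltnNge leq_addl addnK.
by rewrite prodr_const card_ord.
Qed.

(** This gives access to the determinant of multiplication by [X - x] through
    the characteristic polynomial of the companion matrix. *)
Lemma mulmod_mxX (F : fieldType) (Q : {poly F}) : Q \is monic ->
  mulmod_mx Q (size Q).-1 'X = companionmx Q.
Proof.
move=> Qm; apply/row_matrixP=> i; rewrite rowE mul_mulmod_mx rVpoly_delta.
have Q0 := monic_neq0 Qm; have sQ : size Q = (size Q).-1.+1.
  by rewrite prednK // size_poly_gt0.
rewrite -exprSr; apply/rowP=> j; rewrite !mxE.
have [iE|iN] := eqVneq; last first.
  rewrite modp_small ?coefXn 1?eq_sym // size_polyXn.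
  move/eqP: iN (ltn_ord i); case: (size Q) sQ i => [|[|d]] //= _ i; lia.
have -> : i.+1 = (size Q).-1 by rewrite iE prednK // (leq_ltn_trans _ (ltn_ord i)).
have -> : 'X ^+ (size Q).-1 = 1 * Q + ('X ^+ (size Q).-1 - Q) by rewrite mul1r addrC subrK.
rewrite modpD modp_mull add0r modp_small; last first.
  rewrite -[ltnRHS]prednK ?size_poly_gt0 // ltnS; apply/leq_sizeP => k.
  rewrite leq_eqVlt coefB coefXn.
  case/orP=> [/eqP <-|kl].
    by rewrite eqxx -[Q`_ _]/(lead_coef Q) (eqP Qm) subrr.
  by rewrite nth_default ?subr0 ?gtn_eqF // (leq_trans (leqSpred _)).
by rewrite coefB coefXn ltn_eqF // sub0r.
Qed.

Lemma det_mulmod_mxXsubC (F : fieldType) (Q : {poly F}) x d :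
  size Q = d.+1 ->
  lead_coef Q * \det (mulmod_mx Q d ('X - x%:P)) = (-1) ^+ d * Q.[x].
Proof.
move=> sQ; have Q0 : Q != 0 by rewrite -size_poly_gt0 sQ.
have l0 : lead_coef Q != 0 by rewrite lead_coef_eq0.
(* Reduction modulo [Q] or modulo its monic multiple [Q1] is the same. *)
pose Q1 := (lead_coef Q)^-1 *: Q.
have Q1m : Q1 \is monic by rewrite monicE lead_coefZ mulVf.
have sQ1 : d = (size Q1).-1 by rewrite size_scale ?invr_eq0 // sQ.
have QE : Q = lead_coef Q *: Q1 by rewrite scalerA mulfV // scale1r.
rewrite [in RHS]QE hornerZ mulrCA; congr (_ * _).
rewrite QE mulmod_mxZr // sQ1.
have sQ1' : size Q1 = (size Q1).-1.+1 by rewrite -sQ1 size_scale ?invr_eq0.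
transitivity (\det (- (x%:M - companionmx Q1))).
  congr (\det _); rewrite opprB -mulmod_mxX // -(mulmod_mxC x sQ1').
  by apply/row_matrixP=> i; rewrite !rowE mulmxBr !mul_mulmod_mx mulrBr modpD modpN linearB.
(* What remains is the characteristic polynomial evaluated at [x]. *)
rewrite -scaleN1r detZ; congr (_ * _).
rewrite -[in RHS](companionmxK Q1m) /char_poly -horner_evalE -det_map_mx /=.
congr (\det _); apply/matrixP=> i j; rewrite !mxE /horner_eval.
by rewrite !hornerE hornerMn hornerX.
Qed.

(** Split [P] into linear factors: the multiplication matrix of [P] is the
    product of those of its factors, whose determinants are values of [Q]. *)
Lemma resultant_prod_roots (F : fieldType) (P Q : {poly F}) (rP rQ : seq F) :
    P != 0 -> Q != 0 ->
    P = lead_coef P *: \prod_(x <- rP) ('X - x%:P) ->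
    Q = lead_coef Q *: \prod_(y <- rQ) ('X - y%:P) ->
  resultant P Q = lead_coef P ^+ (size Q).-1 * lead_coef Q ^+ (size P).-1 *
    \prod_(x <- rP) \prod_(y <- rQ) (y - x).
Proof.
move=> P0 Q0 PE QE; rewrite resultant_mulmod // mulrAC mulrC; congr (_ * _).
have lQ0 : lead_coef Q != 0 by rewrite lead_coef_eq0.
set d := (size Q).-1; have sQ : size Q = d.+1 by rewrite /d prednK ?size_poly_gt0.
have sr : size rQ = d.
  by apply: succn_inj; rewrite -sQ QE size_scale // size_prod_XsubC.
rewrite {1}PE -mul_polyC mulmod_mxM // mulmod_mxC // det_mulmx det_scalar.
congr (_ * _); elim: (rP) => [|x r IH].
  by rewrite !big_nil mulmod_mxC // det1.
rewrite !big_cons mulmod_mxM // det_mulmx IH; congr (_ * _).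
apply: (mulfI lQ0); rewrite det_mulmod_mxXsubC // [in LHS]QE hornerZ.
rewrite mulrCA; congr (_ * _); rewrite horner_prod -sr.
elim: (rQ) => [|y s IHs]; first by rewrite !big_nil mulr1.
rewrite !big_cons -IHs exprS mulrACA hornerXsubC mulN1r opprB //.
Qed.

(** * Multiplicativity and reduction modulo the second argument *)

Lemma resultantMl (F : fieldType) (P1 P2 Q : {poly F}) :
    P1 != 0 -> P2 != 0 -> Q != 0 ->
  resultant (P1 * P2) Q = resultant P1 Q * resultant P2 Q.
Proof.
move=> P10 P20 Q0; rewrite !resultant_mulmod // mulmod_mxM ?det_mulmx; last first.
  by rewrite prednK // size_poly_gt0.
rewrite mulrACA -exprD size_mul //; congr (_ ^+ _ * _).
by move: P10 P20; rewrite -!size_poly_gt0;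
  case: (size P1) (size P2) => [|a] [|b] // _ _; rewrite addSn addnS.
Qed.

(** Multiplication by [S Q + c P] on [F[X] / (Q)] is [c] times multiplication
    by [P].  The powers of [lc Q] make up for the possible difference of
    degree between [P] and [S Q + c P]. *)
Lemma resultant_modl (F : fieldType) (P S Q : {poly F}) c : Q != 0 ->
  lead_coef Q ^+ (size P).-1 * resultant (S * Q + c *: P) Q =
  lead_coef Q ^+ (size (S * Q + c *: P)).-1 * c ^+ (size Q).-1 * resultant P Q.
Proof.
move=> Q0; rewrite !resultant_mulmod // mulmod_mx_addl -mul_polyC mulmod_mxM.
  by rewrite mulmod_mxC ?det_mulmx ?det_scalar ?prednK ?size_poly_gt0 //; ring.
by rewrite prednK // size_poly_gt0.
Qed.

Lemma map_resultant_inj (aR rR : comNzRingType) (f : {rmorphism aR -> rR})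
    (P Q : {poly aR}) : injective f ->
  f (resultant P Q) = resultant (map_poly f P) (map_poly f Q).
Proof.
move=> fI; rewrite /resultant /Sylvester_mx !size_map_inj_poly ?rmorph0 //.
rewrite -det_map_mx map_col_mx; congr (\det (col_mx _ _));
  by apply/matrixP=> i j; rewrite !mxE /= !rVpoly_delta -coef_map rmorphM /= map_polyXn.
Qed.

Local Notation "P ^%Q" := (map_poly (intr : int -> rat) P) (at level 2).

Lemma int_resultantMl (P1 P2 Q : {poly int}) :
    P1 != 0 -> P2 != 0 -> Q != 0 ->
  resultant (P1 * P2) Q = resultant P1 Q * resultant P2 Q.
Proof.
move=> P10 P20 Q0; apply: (@intr_inj rat).
rewrite rmorphM !map_resultant_inj; try exact: intr_inj.
by rewrite rmorphM resultantMl // map_poly_eq0_id0 // intr_eq0 lead_coef_eq0.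
Qed.

Lemma int_resultant_modl (P S Q : {poly int}) c : Q != 0 ->
  lead_coef Q ^+ (size P).-1 * resultant (S * Q + c *: P) Q =
  lead_coef Q ^+ (size (S * Q + c *: P)).-1 * c ^+ (size Q).-1 * resultant P Q.
Proof.
move=> Q0; apply: (@intr_inj rat).
have sz (U : {poly int}) : size (U^%Q) = size U.
  by rewrite size_map_inj_poly //; exact: intr_inj.
have := @resultant_modl _ P^%Q S^%Q Q^%Q c%:~R.
rewrite -map_polyZ -rmorphM -rmorphD /= !sz lead_coef_map_inj //; last exact: intr_inj.
rewrite -!map_resultant_inj; try exact: intr_inj.
rewrite -!rmorphXn -!rmorphM => -> //.
by rewrite -size_poly_gt0 sz size_poly_gt0.
Qed.

(** * Resultants of polynomials with distant roots *)

Section NormResultant.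
Variable C : numClosedFieldType.
Implicit Types P Q G : {poly int}.

Local Notation "P ^%C" := (map_poly (intr : int -> C) P) (at level 2).

Let intrI : injective (intr : int -> C) := @intr_inj C.

Let map_neq0 P : P != 0 -> P^%C != 0.
Proof. by move=> P0; rewrite map_poly_eq0_id0 // intr_eq0 lead_coef_eq0. Qed.

Lemma norm_resultant_prod_roots P Q (rP rQ : seq C) : P != 0 -> Q != 0 ->
    P^%C = lead_coef P^%C *: \prod_(x <- rP) ('X - x%:P) ->
    Q^%C = lead_coef Q^%C *: \prod_(y <- rQ) ('X - y%:P) ->
  `|(resultant P Q)%:~R : C| =
    `|(lead_coef P)%:~R| ^+ (size Q).-1 * `|(lead_coef Q)%:~R| ^+ (size P).-1 *
    \prod_(x <- rP) \prod_(y <- rQ) `|x - y|.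
Proof.
move=> P0 Q0 PE QE; rewrite map_resultant_inj; last exact: intr_inj.
rewrite (resultant_prod_roots _ _ PE QE) ?map_neq0 //.
rewrite !size_map_inj_poly ?lead_coef_map_inj // !normrM !normrX.
congr (_ * _); rewrite normr_prod; apply: eq_bigr => x _.
by rewrite normr_prod; apply: eq_bigr => y _; rewrite distrC.
Qed.

(** The product formula is symmetric up to the signs of the differences. *)
Lemma absz_resultantC P Q : P != 0 -> Q != 0 ->
  `|resultant P Q|%N = `|resultant Q P|%N.
Proof.
move=> P0 Q0; have [[rP PE] [rQ QE]] := (closed_field_poly_normal P^%C,
  closed_field_poly_normal Q^%C).
apply/eqP; rewrite -(eqr_nat C) !pmulrn !abszE !intr_norm.
rewrite (norm_resultant_prod_roots P0 Q0 PE QE).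
rewrite (norm_resultant_prod_roots Q0 P0 QE PE) exchange_big /= [_ * _ ^+ _]mulrC.
by apply/eqP; congr (_ * _); do 2 (apply: eq_bigr => ? _); rewrite distrC.
Qed.

Lemma prod_gt_expn (T : Type) (r : seq T) (w : T -> C) s : 0 <= s ->
  (0 < size r)%N -> all (fun x => s < w x) r -> s ^+ size r < \prod_(x <- r) w x.
Proof.
move=> s0; elim: r => // x [|y r] IH _ /=; first by rewrite andbT big_seq1.
move=> /andP[sx sr]; rewrite exprS big_cons ltr_pM ?exprn_ge0 //.
exact: IH.
Qed.

(** The leading coefficients are nonzero integers, so they only increase the
    product formula; each root [x] of [P] contributes
    [\prod_y |x - y| > s ^ deg G >= 1], and there is at least one. *)
Lemma norm_resultant_gt P G s : (1 < size P)%N -> (1 < size G)%N ->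
    0 <= s -> 1 <= s ^+ (size G).-1 ->
    (forall x y, root P^%C x -> root G^%C y -> s < `|x - y|) ->
  s ^+ (size G).-1 < `|(resultant P G)%:~R|.
Proof.
move=> sP sG s0 s1 far.
have P0 : P != 0 by rewrite -size_poly_gt0 ltnW.
have G0 : G != 0 by rewrite -size_poly_gt0 ltnW.
have [[rP PE] [rG GE]] := (closed_field_poly_normal P^%C,
  closed_field_poly_normal G^%C).
have lge1 U : U != 0 -> 1 <= `|(lead_coef U)%:~R : C|.
  by move=> U0; rewrite -intr_norm -[1]/(1%:~R) ler_int -gtz0_ge1 normr_gt0 lead_coef_eq0.
have szr U r : U != 0 -> U^%C = lead_coef U^%C *: \prod_(x <- r) ('X - x%:P) ->
    size r = (size U).-1.
  move=> U0 UE; rewrite -(size_map_inj_poly intrI) // UE size_scale.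
    by rewrite size_prod_XsubC.
  by rewrite lead_coef_eq0 map_neq0.
have rootr U r x : U != 0 -> U^%C = lead_coef U^%C *: \prod_(x <- r) ('X - x%:P) ->
    x \in r -> root U^%C x.
  by move=> U0 -> xr; rewrite rootZ ?root_prod_XsubC // lead_coef_eq0 map_neq0.
rewrite (norm_resultant_prod_roots P0 G0 PE GE).
apply: (@lt_le_trans _ _ (\prod_(x <- rP) \prod_(y <- rG) `|x - y|)); last first.
  rewrite ler_peMl //; first by do 2 (rewrite prodr_ge0 // => ? _).
  by rewrite mulr_ege1 // exprn_ege1 // lge1.
have inner x : x \in rP -> s ^+ (size G).-1 < \prod_(y <- rG) `|x - y|.
  move=> xr; rewrite -(szr _ _ G0 GE) prod_gt_expn //.
    by rewrite (szr _ _ G0 GE) -subn1 subn_gt0.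
  by apply/allP=> y yr; apply: far; [apply: rootr PE xr|apply: rootr GE yr].
apply: le_lt_trans (_ : (s ^+ (size G).-1) ^+ size rP < _).
  by rewrite -{1}[s ^+ _]expr1 ler_weXn2l // (szr _ _ P0 PE) -subn1 subn_gt0.
apply: prod_gt_expn; first exact: exprn_ge0.
  by rewrite (szr _ _ P0 PE) -subn1 subn_gt0.
by apply/allP.
Qed.

(** If [h] had two nonconstant integer factors, [p] would divide the resultant
    with [G] of one of them, leaving at most [K] for the other, whereas the
    distance between the roots makes both resultants larger than [K]. *)
Lemma irreducible_of_resultant (h G : {poly int}) (p K : nat) (s : C) :
    (1 < size h)%N -> (1 < size G)%N -> prime p -> (0 < K)%N ->
    `|resultant h G|%N = (p * K)%N -> 0 <= s -> K%:R <= s ^+ (size G).-1 ->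
    (forall x y, root h^%C x -> root G^%C y -> s < `|x - y|) ->
  irreducible_poly h^%Q.
Proof.
move=> sh sG pp K0 hres s0 Ks far.
have szQ (U : {poly int}) : size U^%Q = size U.
  by rewrite size_map_inj_poly //; exact: intr_inj.
have h0 : h != 0 by rewrite -size_poly_gt0 ltnW.
have G0 : G != 0 by rewrite -size_poly_gt0 ltnW.
have s1 : 1 <= s ^+ (size G).-1 by apply: le_trans Ks; rewrite ler1n.
split; first by rewrite szQ.
move=> u su uh; have [u1 [a a0 uE] [r hE]] := dvdpP_rat_int uh.
have [u10 r0] : u1 != 0 /\ r != 0.
  by apply/andP; rewrite -negb_or -mulf_eq0 -hE.
have su1 : size u = size u1 by rewrite uE size_scale // szQ.
rewrite -dvdp_size_eqp // su1 szQ.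
apply: contraT => neq.
have su1gt : (1 < size u1)%N by rewrite ltn_neqAle eq_sym -su1 su su1 size_poly_gt0.
have srgt : (1 < size r)%N.
  rewrite ltn_neqAle size_poly_gt0 r0 andbT eq_sym; apply: contra neq => /eqP sr.
  by rewrite hE size_mul // sr addn1.
have big U V : h = U * V -> (1 < size U)%N -> (K < `|resultant U G|)%N.
  move=> UE sU; rewrite -(ltr_nat C) [ltRHS]pmulrn abszE intr_norm.
  apply: le_lt_trans Ks _; apply: norm_resultant_gt => // x y xr yr.
  by apply: far => //; rewrite UE rmorphM rootM xr.
have b1 := big _ _ hE su1gt.
have b2 : (K < `|resultant r G|)%N by apply: (big _ u1) => //; rewrite mulrC.
have no_multiple i j k : (K < j)%N -> (i * j = p * K)%N -> i = (k * p)%N -> false.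
  move=> Kj ijE iE; move: ijE; rewrite iE mulnAC mulnC => /eqP.
  rewrite eqn_pmul2l ?prime_gt0 // => /eqP kj.
  by move: K0 Kj; rewrite -kj; case: k {iE kj} => // k _; rewrite mulSn; lia.
have resE : (`|resultant u1 G| * `|resultant r G| = p * K)%N.
  by rewrite -abszM -int_resultantMl // -hE.
have : (p %| `|resultant u1 G| * `|resultant r G|)%N by rewrite resE dvdn_mulr.
rewrite Euclid_dvdM // => /orP[] /dvdnP[k]; first exact: no_multiple b2 resE.
by apply: no_multiple b1 _; rewrite mulnC.
Qed.

End NormResultant.

(** * Cauchy bounds on roots *)

Section CauchyBounds.
Variable C : numFieldType.
Implicit Types (P : {poly C}) (c z : C).

Lemma root_norm_lead P n z : (size P <= n.+1)%N -> root P z ->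
  `|P`_n| * `|z| ^+ n <= \sum_(0 <= i < n) `|P`_i| * `|z| ^+ i.
Proof.
move=> sP /rootP; rewrite (horner_coef_wide _ sP) big_ord_recr /= => /eqP.
rewrite addr_eq0 => /eqP Pz; rewrite -normrX -normrM -normrN -Pz big_mkord.
by apply: le_trans (ler_norm_sum _ _ _) _; apply: ler_sum => i _; rewrite normrM normrX.
Qed.

Lemma root_norm_const P n z : (size P <= n.+1)%N -> root P z ->
  `|P`_0| <= \sum_(1 <= i < n.+1) `|P`_i| * `|z| ^+ i.
Proof.
move=> sP /rootP; rewrite (horner_coef_wide _ sP) big_ord_recl /= expr0 mulr1 => /eqP.
rewrite addr_eq0 => /eqP ->; rewrite normrN big_add1 /= big_mkord.
by apply: le_trans (ler_norm_sum _ _ _) _; apply: ler_sum => i _; rewrite normrM normrX.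
Qed.

(** At a root, the leading term is dominated by the others.  If [|z| > c], then
    [|z| c^n |z|^i <= c |z|^n c^i] for every [i < n], so that comparing with the
    hypothesis at [c] loses a factor [c / |z| < 1]. *)
Lemma Cauchy_upper_le P n c z : (size P <= n.+1)%N -> P`_n != 0 -> 0 < c ->
    \sum_(0 <= i < n) `|P`_i| * c ^+ i <= `|P`_n| * c ^+ n ->
  root P z -> `|z| <= c.
Proof.
move=> sP Pn c0 bound Pz; have zR := normr_real z; have cR := gtr0_real c0.
rewrite real_leNgt //; apply/negP => cz; have z0 := lt_trans c0 cz.
have : `|z| * `|P`_n| * (c * `|z|) ^+ n <= c * `|P`_n| * (c * `|z|) ^+ n.
  have low := root_norm_lead sP Pz.
  have {low} : `|z| * c ^+ n * (`|P`_n| * `|z| ^+ n) <=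
             `|z| * c ^+ n * (\sum_(0 <= i < n) `|P`_i| * `|z| ^+ i).
    by rewrite ler_pM2l // mulr_gt0 ?exprn_gt0.
  have {bound} : c * `|z| ^+ n * (\sum_(0 <= i < n) `|P`_i| * c ^+ i) <=
           c * `|z| ^+ n * (`|P`_n| * c ^+ n).
    by rewrite ler_pM2l // mulr_gt0 ?exprn_gt0.
  have : `|z| * c ^+ n * (\sum_(0 <= i < n) `|P`_i| * `|z| ^+ i) <=
         c * `|z| ^+ n * (\sum_(0 <= i < n) `|P`_i| * c ^+ i).
    rewrite !mulr_sumr !big_mkord; apply: ler_sum => i _.
    have expn (x : C) : x ^+ n = x ^+ i * (x * x ^+ (n - i.+1)).
      by rewrite -exprS -exprD; congr (_ ^+ _); have := ltn_ord i; lia.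
    rewrite !expn; set k := (n - _)%N.
    have -> : `|z| * (c ^+ i * (c * c ^+ k)) * (`|P`_i| * `|z| ^+ i)
      = (`|P`_i| * c ^+ i * `|z| ^+ i * c * `|z|) * c ^+ k by ring.
    have -> : c * (`|z| ^+ i * (`|z| * `|z| ^+ k)) * (`|P`_i| * c ^+ i)
      = (`|P`_i| * c ^+ i * `|z| ^+ i * c * `|z|) * `|z| ^+ k by ring.
    rewrite ler_wpM2l //; first by rewrite !mulr_ge0 ?exprn_ge0 // ltW.
    by rewrite lerXn2r ?nnegrE ?ltW.
  move=> h1 h2 h3; have := le_trans h3 (le_trans h1 h2).
  by rewrite !exprMn; congr (_ <= _); ring.
rewrite ler_pM2r ?exprn_gt0 ?mulr_gt0 // ler_pM2r ?normr_gt0 //.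
by rewrite real_leNgt ?cz.
Qed.

Lemma Cauchy_upper_lt P n c z : (size P <= n.+1)%N -> 0 < c ->
    \sum_(0 <= i < n) `|P`_i| * c ^+ i < `|P`_n| * c ^+ n ->
  root P z -> `|z| < c.
Proof.
move=> sP c0 bound Pz; have Pn : P`_n != 0.
  apply: contraTneq bound => ->; rewrite normr0 mul0r le_gtF //.
  by apply: sumr_ge0 => i _; rewrite mulr_ge0 ?exprn_ge0 // ltW.
rewrite lt_neqAle (Cauchy_upper_le sP Pn c0 (ltW bound) Pz) andbT.
apply: contraTneq bound => <-; have low := root_norm_lead sP Pz.
by rewrite le_gtF.
Qed.

(** The mirror image of the previous bound, with the constant term dominating:
    if [|z| < c], then [c |z|^i <= |z| c^i] for every [i >= 1]. *)
Lemma Cauchy_lower_le P n c z : (size P <= n.+1)%N -> P`_0 != 0 -> 0 < c ->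
    \sum_(1 <= i < n.+1) `|P`_i| * c ^+ i <= `|P`_0| ->
  root P z -> c <= `|z|.
Proof.
move=> sP P0 c0 bound Pz; have zR := normr_real z; have cR := gtr0_real c0.
rewrite real_leNgt //; apply/negP => zc.
have low := root_norm_const sP Pz.
have : c * `|P`_0| <= `|z| * `|P`_0|.
  have h1 : c * `|P`_0| <= c * \sum_(1 <= i < n.+1) `|P`_i| * `|z| ^+ i.
    by rewrite ler_pM2l.
  have h2 : `|z| * \sum_(1 <= i < n.+1) `|P`_i| * c ^+ i <= `|z| * `|P`_0|.
    by rewrite ler_wpM2l.
  apply: le_trans h1 _; apply: le_trans h2.
  rewrite !mulr_sumr !big_add1 /= !big_mkord; apply: ler_sum => i _.
  rewrite !exprS.
  have -> : c * (`|P`_i.+1| * (`|z| * `|z| ^+ i)) =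
    (`|P`_i.+1| * c * `|z|) * `|z| ^+ i by ring.
  have -> : `|z| * (`|P`_i.+1| * (c * c ^+ i)) =
    (`|P`_i.+1| * c * `|z|) * c ^+ i by ring.
  rewrite ler_wpM2l //; first by rewrite !mulr_ge0 // ltW.
  by rewrite lerXn2r ?nnegrE ?(ltW c0) ?(ltW zc).
by rewrite ler_pM2r ?normr_gt0 // real_leNgt ?zc.
Qed.

Lemma Cauchy_lower_lt P n c z : (size P <= n.+1)%N -> 0 < c ->
    \sum_(1 <= i < n.+1) `|P`_i| * c ^+ i < `|P`_0| ->
  root P z -> c < `|z|.
Proof.
move=> sP c0 bound Pz; have P0 : P`_0 != 0.
  apply: contraTneq bound => ->; rewrite normr0 le_gtF //.
  by apply: sumr_ge0 => i _; rewrite mulr_ge0 ?exprn_ge0 // ltW.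
rewrite lt_neqAle (Cauchy_lower_le sP P0 c0 (ltW bound) Pz) andbT.
apply: contraTneq bound => ->; have low := root_norm_const sP Pz.
by rewrite le_gtF.
Qed.

End CauchyBounds.

(** * Roots of integer polynomials over a real closed field *)

Section TransferToComplex.
Variable R : rcfType.
Implicit Types (P : {poly int}) (c : R).
Local Open Scope complex_scope.

Local Notation "P ^%C" := (map_poly (intr : int -> R[i]) P) (at level 2).

Let norm_intC (z : int) : `|z%:~R : R[i]| = (`|z%:~R : R|)%:C.
Proof. by rewrite -!intr_norm rmorph_int. Qed.

Let size_mapC P : size P^%C = size P.
Proof. by rewrite size_map_inj_poly //; exact: intr_inj. Qed.

Let sum_mapC P c a b :
  \sum_(a <= i < b) `|P^%C`_i| * c%:C ^+ i =
  (\sum_(a <= i < b) `|(P`_i)%:~R| * c ^+ i)%:C.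
Proof.
rewrite rmorph_sum; apply: eq_bigr => i _.
by rewrite coef_map norm_intC rmorphM rmorphXn.
Qed.

Lemma complex_root_le P n c (z : R[i]) : (size P <= n.+1)%N -> P`_n != 0 -> 0 < c ->
    \sum_(0 <= i < n) `|(P`_i)%:~R| * c ^+ i <= `|(P`_n)%:~R| * c ^+ n ->
  root P^%C z -> `|z| <= c%:C.
Proof.
move=> sP Pn c0 bound; apply: (Cauchy_upper_le (n := n)).
- by rewrite size_mapC.
- by rewrite coef_map intr_eq0.
- by rewrite ltcR.
by rewrite sum_mapC coef_map norm_intC -rmorphXn -rmorphM lecR.
Qed.

Lemma complex_root_lt P n c (z : R[i]) : (size P <= n.+1)%N -> 0 < c ->
    \sum_(0 <= i < n) `|(P`_i)%:~R| * c ^+ i < `|(P`_n)%:~R| * c ^+ n ->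
  root P^%C z -> `|z| < c%:C.
Proof.
move=> sP c0 bound; apply: (Cauchy_upper_lt (n := n)).
- by rewrite size_mapC.
- by rewrite ltcR.
by rewrite sum_mapC coef_map norm_intC -rmorphXn -rmorphM ltcR.
Qed.

Lemma complex_root_ge P n c (z : R[i]) : (size P <= n.+1)%N -> P`_0 != 0 -> 0 < c ->
    \sum_(1 <= i < n.+1) `|(P`_i)%:~R| * c ^+ i <= `|(P`_0)%:~R| ->
  root P^%C z -> c%:C <= `|z|.
Proof.
move=> sP P0 c0 bound; apply: (Cauchy_lower_le (n := n)).
- by rewrite size_mapC.
- by rewrite coef_map intr_eq0.
- by rewrite ltcR.
by rewrite sum_mapC coef_map norm_intC lecR.
Qed.

Lemma complex_root_gt P n c (z : R[i]) : (size P <= n.+1)%N -> 0 < c ->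
    \sum_(1 <= i < n.+1) `|(P`_i)%:~R| * c ^+ i < `|(P`_0)%:~R| ->
  root P^%C z -> c%:C < `|z|.
Proof.
move=> sP c0 bound; apply: (Cauchy_lower_lt (n := n)).
- by rewrite size_mapC.
- by rewrite ltcR.
by rewrite sum_mapC coef_map norm_intC ltcR.
Qed.

(** The triangle inequality turns the separation of the moduli into the
    separation of the roots. *)
Lemma annuli_irreducible (h G : {poly int}) (p K : nat) (s r1 r2 : R) :
    (1 < size h)%N -> (1 < size G)%N -> prime p -> (0 < K)%N ->
    `|resultant h G|%N = (p * K)%N -> 0 <= s -> K%:R <= s ^+ (size G).-1 ->
    r1 + s <= r2 ->
    (forall x, root h^%C x -> `|x| <= r1%:C) /\ (forall y, root G^%C y -> r2%:C < `|y|)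
    \/ (forall x, root h^%C x -> r2%:C <= `|x|) /\ (forall y, root G^%C y -> `|y| < r1%:C) ->
  irreducible_poly (map_poly (intr : int -> rat) h).
Proof.
move=> sh sG pp K0 hres s0 Ks rr loc.
apply: (@irreducible_of_resultant R[i] h G p K s%:C) => //.
- by rewrite lecR.
- by rewrite -(rmorph_nat (real_complex R)) -rmorphXn lecR.
move=> x y hx hy.
have far u v : u <= r1%:C -> r2%:C <= v -> s%:C <= v - u.
  move=> ur rv; apply: le_trans (lerB rv ur).
  by rewrite -rmorphB lecR lerBrDl.
case: loc => [[/(_ x hx) xr /(_ y hy) yr]|[/(_ x hx) xr /(_ y hy) yr]].
- rewrite distrC; apply: lt_le_trans (lerB_dist _ _).
  apply: le_lt_trans (far _ _ xr (lexx _)) _; by rewrite ltrD2r.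
apply: lt_le_trans (lerB_dist _ _).
apply: le_lt_trans (far _ _ (lexx _) xr) _; by rewrite ltrD2l ltrN2.
Qed.

End TransferToComplex.

(** * Coefficient estimates for linear combinations *)

Section Combination.
Variable R : realFieldType.
Implicit Types (f g : {poly int}) (c : R) (M N : int).

Lemma sum_zpow_shift (P : {poly int}) c a b n : c != 0 ->
  \sum_(a <= i < b) `|(P`_i)%:~R| * c ^ (i%:Z - n%:Z) =
  (\sum_(a <= i < b) `|(P`_i)%:~R| * c ^+ i) / c ^+ n :> R.
Proof.
move=> c0; rewrite mulr_suml; apply: eq_bigr => i _.
by rewrite expfzDr // -exprnN mulrA.
Qed.

Lemma norm_combination f g M N i :
  `|((M *: f + N *: g)`_i)%:~R| <=
    `|M%:~R| * `|(f`_i)%:~R| + `|N%:~R| * `|(g`_i)%:~R| :> R.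
Proof.
by rewrite coefD !coefZ rmorphD !rmorphM -!normrM ler_normD.
Qed.

Lemma norm_combination_sum f g M N c a b : 0 <= c ->
  \sum_(a <= i < b) `|((M *: f + N *: g)`_i)%:~R| * c ^+ i <=
  `|M%:~R| * (\sum_(a <= i < b) `|(f`_i)%:~R| * c ^+ i) +
  `|N%:~R| * (\sum_(a <= i < b) `|(g`_i)%:~R| * c ^+ i).
Proof.
move=> c0; rewrite !mulr_sumr -big_split /=; apply: ler_sum => i _.
by rewrite !mulrA -mulrDl ler_wpM2r ?exprn_ge0 // norm_combination.
Qed.

Lemma sum_size_trunc (P : {poly int}) c a m n : (size P <= m)%N -> (a <= m <= n)%N ->
  \sum_(a <= i < n) `|(P`_i)%:~R| * c ^+ i =
  \sum_(a <= i < m) `|(P`_i)%:~R| * c ^+ i.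
Proof.
move=> sP /andP[am mn]; rewrite (big_cat_nat (n := m)) //=.
rewrite [X in _ + X](_ : _ = 0) ?addr0 // big_nat_cond big1 // => i /andP[/andP[mi _] _].
by rewrite nth_default ?(leq_trans sP) // normr0 mul0r.
Qed.

Lemma sum_norm_coef_gt0 (P : {poly int}) c n : P`_0 != 0 -> 0 < c ->
  0 < \sum_(0 <= i < n.+1) `|(P`_i)%:~R| * c ^+ i.
Proof.
move=> P0 c0; rewrite big_nat_recl // expr0 mulr1 ltr_pwDl //.
  by rewrite normr_gt0 intr_eq0.
by apply: sumr_ge0 => i _; rewrite mulr_ge0 ?exprn_ge0 // ltW.
Qed.

(** The hypothesis says that the coefficients of [M f] and [N g] below degree
    [n] are together dominated at [c] by that of [M f] in degree [n], which
    [N g] does not affect because [m < n]. *)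
Lemma upper_bound_combination f g M N n m c :
    (m < n)%N -> (size g <= m.+1)%N -> 0 < c -> g`_0 != 0 ->
    `|N%:~R| <= `|M%:~R| *
      ((`|(f`_n)%:~R| - \sum_(0 <= i < n) `|(f`_i)%:~R| * c ^ (i%:Z - n%:Z))
       / \sum_(0 <= i < m.+1) `|(g`_i)%:~R| * c ^ (i%:Z - n%:Z)) ->
  \sum_(0 <= i < n) `|((M *: f + N *: g)`_i)%:~R| * c ^+ i <=
    `|((M *: f + N *: g)`_n)%:~R| * c ^+ n.
Proof.
move=> mn sg c0 g0; rewrite !sum_zpow_shift ?gt_eqF //.
have cn : 0 < c ^+ n by rewrite exprn_gt0.
have Sb := sum_norm_coef_gt0 m g0 c0.
rewrite mulrA ler_pdivlMr ?divr_gt0 // mulrA ler_pdivrMr //.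
rewrite -mulrA mulrBl divfK ?gt_eqF // => bound.
apply: le_trans (norm_combination_sum f g M N 0 n (ltW c0)) _.
rewrite (sum_size_trunc c sg) //.
rewrite coefD !coefZ [g`_n]nth_default ?(leq_trans sg) // mulr0 addr0.
rewrite rmorphM normrM -mulrA.
by rewrite mulrBr lerBrDl in bound.
Qed.

(** In the hypothesis the sum over [f] includes its constant term, which pays for
    the difference between the constant coefficient of [h] and that of [N g]. *)
Lemma lower_bound_combination f g M N n m c :
    (m < n)%N -> (size g <= m.+1)%N -> 0 < c -> f`_0 != 0 ->
    `|M%:~R| <= `|N%:~R| *
      ((`|(g`_0)%:~R| - \sum_(1 <= i < m.+1) `|(g`_i)%:~R| * c ^+ i)
       / \sum_(0 <= i < n.+1) `|(f`_i)%:~R| * c ^+ i) ->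
  \sum_(1 <= i < n.+1) `|((M *: f + N *: g)`_i)%:~R| * c ^+ i <=
    `|((M *: f + N *: g)`_0)%:~R|.
Proof.
move=> mn sg c0 f0; have Sa := sum_norm_coef_gt0 n f0 c0.
rewrite mulrA ler_pdivlMr // big_nat_recl // expr0 mulr1 => bound.
apply: le_trans (norm_combination_sum f g M N 1 n.+1 (ltW c0)) _.
rewrite (sum_size_trunc c sg) ?ltnS ?(ltnW mn) //.
apply: (@le_trans _ _ (`|N%:~R| * `|(g`_0)%:~R| - `|M%:~R| * `|(f`_0)%:~R|)).
  by rewrite big_add1 /=; move: bound; lra.
have := lerB_dist ((N * g`_0)%:~R : R) (- (M * f`_0)%:~R).
by rewrite normrN opprK coefD !coefZ [M * _ + _]addrC rmorphD !rmorphM !normrM.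
Qed.

End Combination.

(** * The irreducibility criterion *)

Lemma powR_root (R : realType) (x : R) (k m : nat) : 0 <= x -> (0 < m)%N ->
  (x `^ (k%:R / m%:R)) ^+ m = x ^+ k.
Proof.
move=> x0 m0; rewrite -powR_mulrn ?powR_ge0 // -powRrM divfK ?powR_mulrn //.
by rewrite pnatr_eq0 -lt0n.
Qed.

Lemma size_exact (P : {poly int}) n : (size P <= n.+1)%N -> P`_n != 0 -> size P = n.+1.
Proof.
move=> sP Pn; apply/eqP; rewrite eqn_leq sP ltnNge; apply: contraNN Pn => sn.
by rewrite nth_default.
Qed.

Theorem theorem6p9 (R : realType) (n m : nat) (f g : {poly int}) (p q : nat)
    (A B : R) (M N : int)
    (hm : (1 <= m)%N) (hmn : (m < n)%N)
    (hf : (size f <= n.+1)%N) (hg : (size g <= m.+1)%N)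
    (hcoef : f`_0 * f`_n * g`_0 * g`_m != 0)
    (hp : prime p) (hq : (0 < q)%N)
    (hres : `|resultant f g|%N = (p * q)%N)
    (hA : 0 < A) (hB : 0 < B)
    (hAB : A + q%:R `^ (m%:R^-1) <= B)
    (hfA : \sum_(0 <= i < n) `|(f`_i)%:~R| * A ^ (i%:Z - n%:Z)
           < `|(f`_n)%:~R|)
    (hgB : \sum_(1 <= i < m.+1) `|(g`_i)%:~R| * B ^+ i < `|(g`_0)%:~R|)
    (hMN : M * f`_0 + N * g`_0 != 0)
    (hineq :
      (`|M%:~R| <= (B - A) / q%:R `^ (m%:R^-1)
       /\ `|N%:~R| <= `|M%:~R| *
          ((`|(f`_n)%:~R| - \sum_(0 <= i < n) `|(f`_i)%:~R| *
              (B - q%:R `^ (m%:R^-1) * `|M%:~R|) ^ (i%:Z - n%:Z))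
           / \sum_(0 <= i < m.+1) `|(g`_i)%:~R| *
              (B - q%:R `^ (m%:R^-1) * `|M%:~R|) ^ (i%:Z - n%:Z)))
      \/
      (`|N%:~R| `^ (n%:R / m%:R)
         <= (B - A) / (q%:R `^ (m%:R^-1) *
                       `|(f`_n)%:~R| `^ ((n%:R - m%:R) / m%:R))
       /\ `|M%:~R| <= `|N%:~R| *
          ((`|(g`_0)%:~R| - \sum_(1 <= i < m.+1) `|(g`_i)%:~R| *
              (A + q%:R `^ (m%:R^-1)
                   * `|(f`_n)%:~R| `^ ((n%:R - m%:R) / m%:R)
                   * `|N%:~R| `^ (n%:R / m%:R)) ^+ i)
           / \sum_(0 <= i < n.+1) `|(f`_i)%:~R| *
              (A + q%:R `^ (m%:R^-1)
                   * `|(f`_n)%:~R| `^ ((n%:R - m%:R) / m%:R)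
                   * `|N%:~R| `^ (n%:R / m%:R)) ^+ i))) :
  irreducible_poly (map_poly (intr : int -> rat) (M *: f + N *: g)).
Proof.
have [[[f0 fn] g0] gm] : ((f`_0 != 0 /\ f`_n != 0) /\ g`_0 != 0) /\ g`_m != 0.
  by move: hcoef; rewrite !mulf_eq0 !negb_or => /andP[/andP[/andP[-> ->] ->] ->].
have sf := size_exact hf fn; have sg := size_exact hg gm.
have fP0 : f != 0 by rewrite -size_poly_gt0 sf.
have gP0 : g != 0 by rewrite -size_poly_gt0 sg.
set h := M *: f + N *: g.
have h0 : h`_0 != 0 by rewrite coefD !coefZ.
have sh_le : (size h <= n.+1)%N.
  apply: leq_trans (size_polyD _ _) _; rewrite geq_max.
  by rewrite !(leq_trans (size_scale_leq _ _)) ?sf ?sg // ltnW.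
have hn : h`_n = M * f`_n.
  by rewrite coefD !coefZ [g`_n]nth_default ?sg // mulr0 addr0.
have sh_M : M != 0 -> size h = n.+1.
  by move=> M0; apply: size_exact; rewrite ?hn ?mulf_neq0.
set t := q%:R `^ (m%:R^-1) in hAB hineq.
have t0 : 0 <= t by rewrite powR_ge0.
have tpos : 0 < t by rewrite powR_gt0 // ltr0n.
have tm : t ^+ m = q%:R.
  by have := powR_root 1 (ler0n R q) hm; rewrite mul1r expr1.
have natz (z : int) : `|z%:~R : R| = (`|z|%N)%:R.
  by rewrite -intr_norm -abszE pmulrn.
case: hineq => [[hM hN]|[_ hM]].
- have M0 : M != 0.
    apply: contraNneq hMN => M0; move: hN; rewrite M0 normr0 mul0r normr_le0 intr_eq0.
    by move=> /eqP ->; rewrite !mul0r addr0.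
  (* Roots of [h] lie in [|z| <= B - s], those of [g] in [|z| > B]. *)
  set s := t * `|M%:~R| in hN.
  have s0 : 0 <= s by rewrite mulr_ge0.
  have sBA : s <= B - A by rewrite /s mulrC -ler_pdivlMr.
  have c0 : 0 < B - s by apply: lt_le_trans hA _; rewrite lerBrDr addrC -lerBrDr.
  have hres' : `|resultant h g|%N = (p * (q * `|M| ^ m))%N.
    have := int_resultant_modl f N%:P M gP0.
    rewrite mul_polyC addrC -/h sh_M // sf sg /= -mulrA => /mulfI.
    rewrite expf_eq0 lead_coef_eq0 (negPf gP0) andbF => /(_ isT) ->.
    by rewrite abszM abszX hres mulnC mulnA.
  apply: (@annuli_irreducible R h g p (q * `|M| ^ m) s (B - s) B) => //.
  + by rewrite sh_M // ltnS (leq_ltn_trans _ hmn).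
  + by rewrite sg.
  + by rewrite muln_gt0 hq expn_gt0 absz_gt0 M0.
  + by rewrite sg /= natrM natrX -natz exprMn tm.
  + by rewrite subrK.
  left; split=> z.
    apply: (complex_root_le sh_le) => //; first by rewrite hn mulf_neq0.
    exact: upper_bound_combination hN.
  exact: (complex_root_gt hg hB hgB).
have N0 : N != 0.
  apply: contraNneq hMN => N0; move: hM; rewrite N0 normr0 mul0r normr_le0 intr_eq0.
  by move=> /eqP ->; rewrite !mul0r addr0.
(* Roots of [f] lie in [|z| < A], those of [h] in [|z| >= A + s]. *)
set s := t * _ * _ in hM.
have sm : s ^+ m = (q * `|(f`_n)%R| ^ (n - m) * `|N| ^ n)%N%:R.
  rewrite /s !exprMn tm -natrB ?(ltnW hmn) // !powR_root //.
  by rewrite !natz !natrM !natrX.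
have s0 : 0 <= s by rewrite !mulr_ge0 ?powR_ge0.
have K1 : (0 < q * `|(f`_n)%R| ^ (n - m) * `|N| ^ n)%N.
  by rewrite !muln_gt0 hq !expn_gt0 !absz_gt0 fn N0.
have s1 : 1 <= s.
  by rewrite -(@expr_ge1 _ m) // sm ler1n.
have c0 : 0 < A + s by rewrite ltr_wpDr.
(* When [M = 0] the degree of [h] drops to [m]; hence the exponent [d]. *)
have sh_ge : (m < size h)%N.
  have [M0|M0] := eqVneq M 0; last by rewrite sh_M // ltnW.
  by rewrite /h M0 scale0r add0r size_scale // sg.
set d := ((size h).-1 - m)%N.
have hres' : `|resultant h f|%N = (p * (q * `|(f`_n)%R| ^ d * `|N| ^ n))%N.
  have := int_resultant_modl g M%:P N fP0.
  rewrite mul_polyC -/h sf sg /=.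
  have -> : lead_coef f = f`_n by rewrite lead_coefE sf.
  have -> : (size h).-1 = (m + d)%N by rewrite subnKC // -ltnS prednK // (leq_trans _ sh_ge).
  rewrite exprD -!mulrA => /mulfI.
  rewrite expf_eq0 (negPf fn) andbF => /(_ isT) ->.
  rewrite abszM [X in (_ * X)%N]abszM !abszX (absz_resultantC algC) // hres.
  by rewrite mulnA mulnC -!mulnA.
apply: (@annuli_irreducible R h f p (q * `|(f`_n)%R| ^ d * `|N| ^ n) s A (A + s)) => //.
- by rewrite (leq_trans _ sh_ge).
- by rewrite sf ltnS (leq_trans _ hmn).
- by rewrite !muln_gt0 hq !expn_gt0 !absz_gt0 fn N0.
- rewrite sf /=; apply: (@le_trans _ _ (s ^+ m)); last first.
    by rewrite ler_weXn2l // ltnW.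
  rewrite sm ler_nat leq_pmul2r ?expn_gt0 ?absz_gt0 ?N0 // leq_pmul2l //.
  rewrite leq_pexp2l ?absz_gt0 // /d leq_sub2r // -ltnS prednK //.
  exact: leq_trans sh_ge.
right; split=> z.
  apply: (complex_root_ge sh_le) => //.
  exact: lower_bound_combination hM.
apply: (complex_root_lt hf) => //; move: hfA; rewrite sum_zpow_shift ?gt_eqF //.
by rewrite ltr_pdivrMr ?exprn_gt0.
Qed.
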